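(* Let $n=4$, or let $n\ge 5$ be odd. Then there exist an integer $p$ with $2\le p\le n$ and a continuous family $(Q_t)_{t\in I}$ ($I\subset\mathbb{R}$ an interval of positive length) of pairwise non-congruent $n$-simplices in $\mathbb{R}^{p,n-p}$ such that, for each $(n-2)$-face, the $(n-2)$-volume of that face of $Q_t$ is independent of $t$, but the $n$-volume of $Q_t$ is not constant in $t$.
   Context: For $0\le p\le n$, $\mathbb{R}^{p,n-p}$ is the $n$-dimensional real vector space with bilinear product $x\cdot y=x_1y_1+\cdots+x_py_p-x_{p+1}y_{p+1}-\cdots-x_ny_n$. An $n$-simplex in $\mathbb{R}^{p,n-p}$ is the convex hull of $n+1$ affinely independent (labeled) points; its $k$-faces are the $k$-simplices spanned by $k+1$ of its vertices. For a $k$-simplex $G$, choose a vertex as base point and let $u_1,\dots,u_k$ be the vectors from it to the other vertices; the $k$-volume of $G$ is $V_k(G)=|\det(u_i\cdot u_j)_{1\le i,j\le k}|^{1/2}/k!$ (independent of the base point). A continuous family of $n$-simplices is a family indexed by a real interval whose vertices depend continuously on the parameter (faces at different parameters correspond via the vertex labels). Two simplices are congruent if an isometry of $\mathbb{R}^{p,n-p}$ maps one onto the other. *)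

(* Defs.v *)
From mathcomp Require Import all_boot all_order all_algebra.
From mathcomp Require Import all_classical all_reals all_analysis.

Set Implicit Arguments.
Unset Strict Implicit.
Unset Printing Implicit Defensive.

Import Order.TTheory GRing.Theory Num.Theory.
Import numFieldNormedType.Exports.

Local Open Scope classical_set_scope.
Local Open Scope ring_scope.

(* Coordinates are numbered from 0: the first p ones carry the sign +. *)
Definition pdot (R : realType) (n p : nat) (x y : 'rV[R]_n) : R :=
  \sum_(i < n) (if (i < p)%N then x 0 i * y 0 i else - (x 0 i * y 0 i)).

Definition affinely_independent (R : realType) (n k : nat)
    (P : 'I_k.+1 -> 'rV[R]_n) : Prop :=
  forall c : 'I_k.+1 -> R,
    \sum_i c i = 0 -> \sum_i c i *: P i = 0 -> forall i, c i = 0.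

Definition hull (R : realType) (n k : nat) (P : 'I_k.+1 -> 'rV[R]_n) :
    set 'rV[R]_n :=
  [set x | exists w : 'I_k.+1 -> R,
    [/\ forall i, 0 <= w i, \sum_i w i = 1 & x = \sum_i w i *: P i]].

(* P ord0 is the base point. *)
Definition gram (R : realType) (n p k : nat) (P : 'I_k.+1 -> 'rV[R]_n) :
    'M[R]_k :=
  \matrix_(i, j) pdot p (P (lift ord0 i) - P ord0) (P (lift ord0 j) - P ord0).

Definition volume (R : realType) (n p k : nat) (P : 'I_k.+1 -> 'rV[R]_n) : R :=
  Num.sqrt `|\det (gram p P)| / k`!%:R.

(* The form is indefinite in general, so that bijectivity and preservation of
   the scalar square of differences take the place of preserving a distance. *)
Definition pisometry (R : realType) (n p : nat) (f : 'rV[R]_n -> 'rV[R]_n) :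
    Prop :=
  bijective f /\
  forall x y, pdot p (f x - f y) (f x - f y) = pdot p (x - y) (x - y).

(* Simplices are compared as point sets: the vertices may be permuted. *)
Definition congruent (R : realType) (n p k : nat)
    (P P' : 'I_k.+1 -> 'rV[R]_n) : Prop :=
  exists2 f : 'rV[R]_n -> 'rV[R]_n, pisometry p f & f @` hull P = hull P'.

Definition continuous_simplex_family (R : realType) (n : nat) (I : interval R)
    (Q : R -> 'I_n.+1 -> 'rV[R]_n) : Prop :=
  (forall t, t \in I -> affinely_independent (Q t)) /\
  (forall i, {within [set` I], continuous (fun t => Q t i)}).

(* Main.v *)
Require Import Defs.
From mathcomp Require Import all_boot all_order all_algebra.
From mathcomp Require Import all_classical all_reals all_analysis.
From mathcomp Require Import perm ring lra.

Set Implicit Arguments.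
Unset Strict Implicit.
Unset Printing Implicit Defensive.

Import Order.TTheory GRing.Theory Num.Theory.
Import numFieldNormedType.Exports.

Local Open Scope classical_set_scope.
Local Open Scope ring_scope.

(** For every n at least 4 the space of signature (2, n-2) contains a flexible
    simplex, obtained as a suspension over a simplex with null facets.

    Put m = n-1.  In the Lorentz space of signature (1, m-1) there is a
    nondegenerate m-simplex Y, with one vertex at the origin, all of whose
    facets have volume zero: every facet lies in a hyperplane with a null
    normal, and the form is degenerate on such a hyperplane
    ([det_gram_null_normal]).  Facet normals are easy to prescribe.  The
    vertices of Y other than the origin form the dual basis of a basis v_j; the
    facets through the origin have the normals v_j, and the last facet has the
    normal sum_j v_j.  So any basis of null vectors with a null sum will do
    ([null_frame]), and one exists as soon as m is at least 3.

    Add one positive coordinate, let e be its unit vector, and let Q_t be the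
    simplex with vertices t Y_i and t^-(m-2) e.  By [det_gram_suspension], for
    any points P_0, ..., P_k the Gram determinant of the simplex spanned by a e
    and the b P_i is
      b^(2(k+1)) det (P_i . P_j) + b^(2k) a^2 det (gram P).
    An (n-2)-face of Q_t either misses the apex, and is then a scaled facet of
    Y, of volume zero; or it contains the apex and m-1 vertices P_i of Y.  In
    that case det (P_i . P_j) vanishes ([det_inner_null]): either some P_i is
    the origin, or the origin and the P_i span a facet of Y, with this Gram
    determinant.  The remaining term has k = m-2, and with b = t and
    a = t^-(m-2) it does not depend on t.  For the whole simplex k = m and the
    P_i include the origin, so that the Gram determinant is t^4 times a nonzero
    constant, and the n-volume is proportional to t^2.

    Congruence is excluded by a metric invariant: the set of all (x-y).(x-y),
    for x and y in the simplex.  Moving the weight of the apex to the origin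
    shows that its infimum for Q_t is t^2 times the one for Y
    ([inf_squared_distances_suspension]), which is negative. *)

(** * The form and its Gram determinants *)

Definition signature_mx (R : realType) (n p : nat) : 'M[R]_n :=
  diag_mx (\row_i (if (i < p)%N then 1 else -1)).

Definition inner_mx (R : realType) (n p k : nat) (P : 'I_k -> 'rV[R]_n) :
    'M[R]_k :=
  \matrix_(i, j) pdot p (P i) (P j).

Lemma pdotE (R : realType) (n p : nat) (x y : 'rV[R]_n) :
  pdot p x y = (x *m signature_mx R n p *m y^T) 0 0.
Proof.
rewrite !mxE /pdot; apply: eq_bigr => i _.
by rewrite mul_mx_diag !mxE; case: ifP => _; rewrite ?mulr1 // mulrN1 mulNr.
Qed.

Lemma pdotC (R : realType) (n p : nat) (x y : 'rV[R]_n) :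
  pdot p x y = pdot p y x.
Proof. by apply: eq_bigr => i _; rewrite mulrC. Qed.

Lemma pdotBl (R : realType) (n p : nat) (x y z : 'rV[R]_n) :
  pdot p (x - y) z = pdot p x z - pdot p y z.
Proof. by rewrite !pdotE !mulmxBl !mxE. Qed.

Lemma pdotBr (R : realType) (n p : nat) (x y z : 'rV[R]_n) :
  pdot p x (y - z) = pdot p x y - pdot p x z.
Proof. by rewrite ![pdot p x _]pdotC pdotBl. Qed.

Lemma pdotZl (R : realType) (n p : nat) (a : R) (x y : 'rV[R]_n) :
  pdot p (a *: x) y = a * pdot p x y.
Proof. by rewrite !pdotE -!scalemxAl mxE. Qed.

Lemma pdotZr (R : realType) (n p : nat) (a : R) (x y : 'rV[R]_n) :
  pdot p x (a *: y) = a * pdot p x y.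
Proof. by rewrite pdotC pdotZl pdotC. Qed.

Lemma pdot0l (R : realType) (n p : nat) (x : 'rV[R]_n) : pdot p 0 x = 0.
Proof. by rewrite pdotE !mul0mx mxE. Qed.

Lemma pdot0r (R : realType) (n p : nat) (x : 'rV[R]_n) : pdot p x 0 = 0.
Proof. by rewrite pdotC pdot0l. Qed.

Lemma pdot_delta (R : realType) (n p : nat) (x : 'rV[R]_n) (i : 'I_n) :
  pdot p x (delta_mx 0 i) = if (i < p)%N then x 0 i else - x 0 i.
Proof.
rewrite /pdot (bigD1 i) //= big1 => [|j ji]; last first.
  by rewrite !mxE eqxx (negPf ji) mulr0 oppr0 if_same.
by rewrite !mxE !eqxx mulr1 addr0.
Qed.

Lemma pdotDr (R : realType) (n p : nat) (x y z : 'rV[R]_n) :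
  pdot p x (y + z) = pdot p x y + pdot p x z.
Proof. by rewrite !pdotE raddfD mulmxDr mxE. Qed.

Lemma pdot_sumr (R : realType) (n p k : nat) (x : 'rV[R]_n)
    (F : 'I_k -> 'rV[R]_n) :
  pdot p x (\sum_j F j) = \sum_j pdot p x (F j).
Proof. exact: (big_morph _ (pdotDr _ x) (pdot0r _ x)). Qed.

Lemma unit_signature_mx (R : realType) (n p : nat) :
  signature_mx R n p \in unitmx.
Proof.
rewrite unitmxE det_diag unitfE; apply/prodf_neq0 => i _; rewrite mxE.
by case: ifP; rewrite ?oppr_eq0 oner_neq0.
Qed.

Lemma inner_mxE (R : realType) (n p k : nat) (P : 'I_k -> 'rV[R]_n) :
  inner_mx p P =
  (\matrix_i P i) *m signature_mx R n p *m (\matrix_i P i)^T.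
Proof.
apply/matrixP => i j; rewrite !mxE pdotE mxE; apply: eq_bigr => l _.
rewrite !mxE; congr (_ * _); apply: eq_bigr => h _; by rewrite !mxE.
Qed.

Lemma gramE (R : realType) (n p k : nat) (P : 'I_k.+1 -> 'rV[R]_n) :
  gram p P = inner_mx p (fun i => P (lift ord0 i) - P ord0).
Proof. by []. Qed.

(** The right hand side has det (gram P) as the coefficient of [a]: subtracting
    the row and the column of the base point from all the others turns the
    matrix into one where [a] occurs only in the corner, next to [gram P].
    This describes det (gram P) without reference to a base point. *)
Lemma det_inner_shift (R : realType) (n p k : nat)
    (P : 'I_k.+1 -> 'rV[R]_n) (a : R) :
  \det (inner_mx p P + const_mx a) =
  \det (inner_mx p P) + a * \det (gram p P).
Proof.
pose L : 'M[R]_(1 + k) := block_mx 1%:M 0 (const_mx (-1)) 1%:M.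
have detL : \det L = 1 by rewrite det_lblock !det1 mulr1.
have detLL A : \det (L *m A *m L^T) = \det A.
  by rewrite !det_mulmx det_tr detL mul1r mulr1.
pose u : 'rV[R]_k := \row_j pdot p (P ord0) (P (lift ord0 j) - P ord0).
pose X : 'M[R]_(1 + k) := inner_mx p P.
have red b : L *m (X + const_mx b) *m L^T =
    block_mx (pdot p (P ord0) (P ord0) + b)%:M u u^T (gram p P).
  rewrite -[X + const_mx b]submxK.
  rewrite /L tr_block_mx !mulmx_block; congr block_mx; apply/matrixP => i j.
  all: rewrite ?mul1mx ?mul0mx ?addr0 ?trmx1 ?trmx0.
  all: rewrite ?mulmx1 ?mulmx0 ?addr0 ?trmx_const.
  - by rewrite !mxE !ord1 !lshift0 eqxx mulr1n.
  - rewrite !(mxE, big_ord1) !ord1 !lshift0 !rshift1 pdotBr; ring.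
  - rewrite !(mxE, big_ord1) !ord1 !lshift0 !rshift1 pdotBr pdotC; ring.
  - rewrite !(mxE, big_ord1) !ord1 !lshift0 !rshift1 !pdotBr !pdotBl; ring.
have := red 0.
rewrite (_ : const_mx 0 = 0) ?addr0; last by apply/matrixP=> i j; rewrite !mxE.
move=> red0.
rewrite -[LHS]detLL red -[\det (inner_mx p P)]detLL red0.
pose C : 'M[R]_(1 + k) := block_mx 1%:M 0 u^T (gram p P).
have <- : \det C = \det (gram p P) by rewrite det_lblock det1 mul1r.
set B := block_mx _ _ _ _; set D := block_mx _ _ _ _.
rewrite -[\det D]mul1r.
have row0E q (x y : 'M[R]_(1, q)) : row' ord0 x = row' ord0 y.
  by apply/matrixP => -[].
apply: (@determinant_multilinear _ _ B D C (lshift k ord0)).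
- rewrite /B /D /C !block_mxEv !rowKu !row_row_mx !scale_row_mx add_row_mx.
  congr row_mx; apply/rowP => j; rewrite !mxE ?ord1 ?mulr1n; ring.
- rewrite /B /D !block_mxEv !(@row'Ku _ 0).
  by rewrite (row0E _ (row_mx _ _) 0) [in RHS](row0E _ (row_mx _ _) 0).
- rewrite /B /C !block_mxEv !(@row'Ku _ 0).
  by rewrite (row0E _ (row_mx _ _) 0) [in RHS](row0E _ (row_mx _ _) 0).
Qed.

Lemma det_gram_perm (R : realType) (n p k : nat)
    (P : 'I_k.+1 -> 'rV[R]_n) (s : 'S_k.+1) :
  \det (gram p (P \o s)) = \det (gram p P).
Proof.
have detE (Q : 'I_k.+1 -> 'rV[R]_n) : \det (gram p Q) =
    \det (inner_mx p Q + const_mx 1) - \det (inner_mx p Q).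
  by rewrite det_inner_shift mul1r addrC addKr.
have detP (A : 'M[R]_k.+1) : \det (row_perm s (col_perm s A)) = \det A.
  rewrite row_permE col_permE !det_mulmx !det_perm odd_permV mulrC -mulrA.
  by rewrite -signr_addb addbb mulr1.
rewrite !{}detE -(detP (inner_mx p P)) -(detP (inner_mx p P + const_mx 1)).
by congr (_ - _); congr (\det _); apply/matrixP => i j; rewrite !mxE.
Qed.

Lemma affinely_independent_gram (R : realType) (n p k : nat)
    (P : 'I_k.+1 -> 'rV[R]_n) :
  \det (gram p P) != 0 -> affinely_independent P.
Proof.
rewrite -unitfE -unitmxE => uG c c0 cP.
pose e i := P (lift ord0 i) - P ord0.
pose d : 'rV[R]_k := \row_i c (lift ord0 i).
have de : d *m (\matrix_i e i) = 0.
  rewrite mulmx_sum_row -[RHS]cP big_ord_recl /=.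
  move: c0; rewrite big_ord_recl => /eqP; rewrite addr_eq0 => /eqP ->.
  rewrite scaleNr scaler_suml -sumrN -big_split /=; apply: eq_bigr => i _.
  by rewrite rowK mxE scalerBr addrC.
have d0 : d = 0.
  by rewrite -[d](mulmxK uG) gramE inner_mxE !mulmxA de !mul0mx.
have ci i : c (lift ord0 i) = 0 by have /rowP/(_ i) := d0; rewrite !mxE.
move=> i; case: (unliftP ord0 i) => [j ->//|->].
by move: c0; rewrite big_ord_recl big1 ?addr0.
Qed.

(** Otherwise the edges would be independent and their span would meet the line
    of [nu] only in 0, so that [nu] and the edges would form a basis; but [nu]
    is orthogonal to all of these vectors, and the form is nondegenerate. *)
Lemma det_gram_null_normal (R : realType) (p k : nat)
    (P : 'I_k.+1 -> 'rV[R]_k.+1) (nu : 'rV[R]_k.+1) :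
  nu != 0 -> pdot p nu nu = 0 ->
  (forall i j, pdot p nu (P i) = pdot p nu (P j)) ->
  \det (gram p P) = 0.
Proof.
move=> nu0 nunu nuP; apply: contrapT => /eqP.
rewrite -unitfE -unitmxE => uG.
pose e i := P (lift ord0 i) - P ord0.
pose E := \matrix_i e i.
pose S := signature_mx R k.+1 p.
have nuE : nu *m S *m E^T = 0.
  apply/rowP => i; rewrite !mxE.
  transitivity (pdot p nu (e i)); last by rewrite pdotBr (nuP _ ord0) subrr.
  by rewrite pdotE !mxE; apply: eq_bigr => l _; rewrite !mxE.
have uB : row_free (col_mx nu E : 'M[R]_(1 + k, k.+1)).
  apply/inj_row_free => v; rewrite -[v]hsubmxK mul_row_col.
  set a := lsubmx v; set b := rsubmx v => ab.
  have b0 : b = 0.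
    have : (a *m nu + b *m E) *m S *m E^T = 0 by rewrite ab !mul0mx.
    rewrite !mulmxDl -!mulmxA (mulmxA nu) nuE mulmx0 add0r !mulmxA -!mulmxA.
    rewrite (mulmxA E) -inner_mxE -gramE.
    by move/(congr1 (mulmx^~ (invmx (gram p P)))); rewrite mulmxK // mul0mx.
  move: ab; rewrite b0 mul0mx addr0 (mx11_scalar a) mul_scalar_mx => /eqP.
  by rewrite scaler_eq0 (negPf nu0) orbF => /eqP ->; rewrite raddf0 row_mx0.
have uB' : (col_mx nu E : 'M[R]_k.+1) \in unitmx by rewrite -row_free_unit.
have uS := unit_signature_mx R k.+1 p.
have nuB : nu *m S *m (col_mx nu E)^T = 0 :> 'rV_(1 + k).
  rewrite tr_col_mx mul_mx_row nuE.
  rewrite (_ : _ *m nu^T = 0) ?row_mx0 //.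
  by apply/matrixP => i j; rewrite !ord1 -pdotE nunu mxE.
have : nu *m S *m (col_mx nu E : 'M[R]_k.+1)^T = 0 by exact: nuB.
move/(congr1 (mulmx^~ (invmx (col_mx nu E : 'M[R]_k.+1)^T))).
rewrite mulmxK ?unitmx_tr // mul0mx => /(congr1 (mulmx^~ (invmx S))).
by rewrite mulmxK // mul0mx; apply/eqP.
Qed.

(** * A simplex with null facets *)

Definition separating (R : realType) (n p : nat) (v : 'I_n -> 'rV[R]_n) :
    Prop :=
  forall w, (forall j, pdot p w (v j) = 0) -> w = 0.

(** The vertices other than the origin form the basis dual to [v]. *)
Definition dual_simplex (R : realType) (n p : nat) (v : 'I_n -> 'rV[R]_n)
    (i : 'I_n.+1) : 'rV[R]_n :=
  if unlift ord0 i is Some j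
  then row j (invmx (signature_mx R n p *m (\matrix_l v l)^T)) else 0.

Lemma dual_simplex0 (R : realType) (n p : nat) (v : 'I_n -> 'rV[R]_n) :
  dual_simplex p v ord0 = 0.
Proof. by rewrite /dual_simplex unlift_none. Qed.

Lemma mulmx_pairing (R : realType) (n p : nat) (v : 'I_n -> 'rV[R]_n) w j :
  (w *m (signature_mx R n p *m (\matrix_l v l)^T)) 0 j = pdot p w (v j).
Proof. by rewrite pdotE mulmxA !mxE; apply: eq_bigr => i _; rewrite !mxE. Qed.

Lemma separating_unitmx (R : realType) (n p : nat) (v : 'I_n -> 'rV[R]_n) :
  separating p v -> signature_mx R n p *m (\matrix_l v l)^T \in unitmx.
Proof.
move=> v_sep; rewrite -row_free_unit; apply/inj_row_free => w w0.
by apply: v_sep => j; rewrite -mulmx_pairing w0 mxE.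
Qed.

Lemma pdot_dual_simplex (R : realType) (n p : nat) (v : 'I_n -> 'rV[R]_n) i j :
  separating p v -> pdot p (dual_simplex p v (lift ord0 i)) (v j) = (i == j)%:R.
Proof.
move=> /separating_unitmx uG.
by rewrite /dual_simplex liftK -mulmx_pairing -row_mul mulVmx // !mxE.
Qed.

Lemma dual_simplex_unique (R : realType) (n p : nat)
    (v : 'I_n -> 'rV[R]_n) w i :
  separating p v -> (forall j, pdot p w (v j) = (i == j)%:R) ->
  dual_simplex p v (lift ord0 i) = w.
Proof.
move=> v_sep wv; apply/eqP; rewrite -subr_eq0; apply/eqP/v_sep => j.
by rewrite pdotBl pdot_dual_simplex // wv subrr.
Qed.

Lemma det_gram_dual_simplex (R : realType) (n p : nat) (v : 'I_n -> 'rV[R]_n) :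
  separating p v -> \det (gram p (dual_simplex p v)) != 0.
Proof.
move=> /separating_unitmx uG; pose G := signature_mx R n p *m (\matrix_l v l)^T.
have -> : gram p (dual_simplex p v) = inner_mx p (fun i => row i (invmx G)).
  apply/matrixP => i j.
  by rewrite !mxE dual_simplex0 !subr0 /dual_simplex !liftK.
have rowsE : \matrix_i row i (invmx G) = invmx G.
  by apply/row_matrixP => i; rewrite rowK.
rewrite inner_mxE rowsE -unitfE -unitmxE !unitmx_mul unitmx_tr unitmx_inv uG.
by rewrite unit_signature_mx.
Qed.

(** The facet opposite to the vertex dual to [v j] has the normal [v j], and the
    facet opposite to the origin has the normal [\sum_j v j]. *)
Lemma det_gram_dual_simplex_facet (R : realType) (k p : nat)
    (v : 'I_k.+1 -> 'rV[R]_k.+1) (a : 'I_k.+1 -> 'I_k.+2) :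
  separating p v -> (forall j, pdot p (v j) (v j) = 0) ->
  pdot p (\sum_j v j) (\sum_j v j) = 0 -> injective a ->
  \det (gram p (dual_simplex p v \o a)) = 0.
Proof.
move=> v_sep v_null nu_null a_inj; set nu := \sum_j v j in nu_null *.
have dual_nu i : pdot p (dual_simplex p v (lift ord0 i)) nu = 1.
  rewrite pdot_sumr (bigD1 i) //= big1 => [|j ji].
    by rewrite addr0 pdot_dual_simplex // eqxx.
  by rewrite pdot_dual_simplex // eq_sym (negPf ji).
have [i ia] : exists i, forall j, a j != i.
  apply: contrapT => a_onto.
  have /choice[g gK] i : exists j, a j = i.
    apply: contrapT => ia; apply: a_onto; exists i => j.
    by apply/eqP => aj; apply: ia; exists j.
  by have := leq_card g (can_inj gK); rewrite !card_ord ltnn.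
case: (unliftP ord0 i) ia => [j ->|->] ia.
  apply: (@det_gram_null_normal _ _ _ _ (v j)) => //.
    apply: contra_eq_neq (pdot_dual_simplex j j v_sep) => ->.
    by rewrite pdot0r eqxx eq_sym oner_neq0.
  suff va h : pdot p (v j) (dual_simplex p v (a h)) = 0.
    by move=> h l; rewrite /= !va.
  case: (unliftP ord0 (a h)) (ia h) => [l ->|->].
    by rewrite (inj_eq lift_inj) pdotC pdot_dual_simplex // => /negPf ->.
  by rewrite dual_simplex0 pdot0r.
apply: (@det_gram_null_normal _ _ _ _ nu) => //.
  apply: contra_eq_neq (dual_nu ord0) => ->.
  by rewrite pdot0r eq_sym oner_neq0.
suff nua h : pdot p nu (dual_simplex p v (a h)) = 1.
  by move=> h l; rewrite /= !nua.
by case: (unliftP ord0 (a h)) (ia h) => [l -> _|->]; rewrite ?eqxx // pdotC.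
Qed.

Lemma lift_ord0F (n : nat) (i : 'I_n) : (lift ord0 i == ord0) = false.
Proof. by rewrite eq_sym (negPf (neq_lift _ _)). Qed.

(** The null vectors [e_0 + e_j], completed by a multiple of [e_0 - e_1]; the
    factor is the one that makes their sum null. *)
Definition null_frame (R : realType) (r : nat) (j : 'I_r.+2) : 'rV[R]_r.+2 :=
  if j == ord0
  then - (r%:R * r.+1%:R / (2 * r.+2%:R)) *:
       (delta_mx 0 ord0 - delta_mx 0 (lift ord0 ord0))
  else delta_mx 0 ord0 + delta_mx 0 j.

Lemma exists_null_facet_simplex (R : realType) (r : nat) : (0 < r)%N ->
  exists Y : 'I_r.+3 -> 'rV[R]_r.+2,
  [/\ Y ord0 = 0, \det (gram 1 Y) != 0,
      forall a : 'I_r.+2 -> 'I_r.+3, injective a ->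
        \det (gram 1 (Y \o a)) = 0
    & exists i, pdot 1 (Y i) (Y i) < 0].
Proof.
move=> r0; pose v := @null_frame R r; pose i1 : 'I_r.+2 := lift ord0 ord0.
pose c : R := - (r%:R * r.+1%:R / (2 * r.+2%:R)).
pose e i : 'rV[R]_r.+2 := delta_mx 0 i.
have c0 : c != 0.
  rewrite oppr_eq0; rewrite mulf_neq0 ?invr_neq0 ?mulf_neq0 //.
  by rewrite pnatr_eq0 -lt0n.
have v0 : v ord0 = c *: (e ord0 - e i1) by rewrite /v /null_frame eqxx.
have vS j : v (lift ord0 j) = e ord0 + e (lift ord0 j).
  by rewrite /v /null_frame lift_ord0F.
have dot0 x : pdot 1 x (v ord0) = c * (x 0 ord0 + x 0 i1).
  by rewrite v0 pdotZr pdotBr !pdot_delta /= opprK.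
have dotS x j : pdot 1 x (v (lift ord0 j)) = x 0 ord0 - x 0 (lift ord0 j).
  by rewrite vS pdotDr !pdot_delta.
have v_null j : pdot 1 (v j) (v j) = 0.
  case: (unliftP ord0 j) => [i ->|->].
    by rewrite dotS vS !mxE !eqxx lift_ord0F eq_sym lift_ord0F /=; ring.
  by rewrite dot0 v0 !mxE !eqxx /=; ring.
have v_sep : separating 1 v.
  move=> w wv.
  have wS j : w 0 (lift ord0 j) = w 0 ord0.
    by apply/eqP; rewrite eq_sym -subr_eq0 -dotS wv.
  have w0 : w 0 ord0 = 0.
    have /eqP := wv ord0; rewrite dot0 wS mulf_eq0 (negPf c0) /= => /eqP; lra.
  apply/rowP => j; rewrite mxE.
  by case: (unliftP ord0 j) => [i ->|->]; rewrite ?wS.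
pose nu : 'rV[R]_r.+2 := \sum_j v j.
have nu0 : nu 0 ord0 = c + r.+1%:R.
  rewrite /nu summxE big_ord_recl v0 !mxE !eqxx /= subr0 mulr1; congr (_ + _).
  rewrite (eq_bigr (fun=> 1)) ?sumr_const ?card_ord // => i _.
  by rewrite vS !mxE !eqxx eq_sym lift_ord0F /= addr0.
have nuS j : nu 0 (lift ord0 j) = 1 - (if j == ord0 then c else 0).
  rewrite /nu summxE big_ord_recl v0 (bigD1 j) //= big1 => [|i ij]; last first.
    rewrite vS !mxE eqxx lift_ord0F (inj_eq lift_inj) eq_sym (negPf ij).
    by rewrite addr0.
  rewrite vS !mxE !eqxx lift_ord0F (inj_eq lift_inj) /=.
  by case: (j == ord0); rewrite /=; ring.
have nu_null : pdot 1 nu nu = 0.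
  rewrite {2}/nu pdot_sumr big_ord_recl dot0 nu0 nuS eqxx.
  under eq_bigr do rewrite dotS nu0 nuS.
  rewrite big_ord_recl eqxx.
  under eq_bigr do rewrite lift_ord0F.
  rewrite sumr_const card_ord -mulr_natl /c -!natr1.
  by field; rewrite !natr1 pnatr_eq0.
exists (dual_simplex 1 v); split.
- exact: dual_simplex0.
- exact: det_gram_dual_simplex.
- by move=> a; apply: det_gram_dual_simplex_facet.
(* The vertex dual to [v_2] is [- e_2]; the index 2 exists as r > 0. *)
have r1 : (1 < r.+1)%N by [].
pose i2 : 'I_r.+2 := lift ord0 (Ordinal r1).
exists (lift ord0 i2).
rewrite (@dual_simplex_unique _ _ _ _ (- e i2)) // => [|j].
  by rewrite -scaleN1r pdotZl pdotZr pdot_delta !mxE !eqxx /=; lra.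
case: (unliftP ord0 j) => [i ->|->]; rewrite ?dot0 ?dotS !mxE /=.
  by rewrite eq_sym; ring.
by ring.
Qed.

(** * Suspension *)

Definition prepend (R : realType) (m : nat) (a : R) (x : 'rV[R]_m) :
  'rV[R]_m.+1 := row_mx a%:M x.

Lemma pdot_prepend (R : realType) (p m : nat) (a b : R) (x y : 'rV[R]_m) :
  pdot p.+1 (prepend a x) (prepend b y) = a * b + pdot p x y.
Proof.
have e0 (u : R) z : (prepend u z : 'rV[R]_m.+1) 0 ord0 = u.
  transitivity (row_mx u%:M z 0 (lshift m ord0)).
    by congr (fun_of_matrix _ _ _); apply: val_inj.
  by rewrite row_mxEl mxE.
have eS (u : R) z i : (prepend u z : 'rV[R]_m.+1) 0 (lift ord0 i) = z 0 i.
  transitivity (row_mx u%:M z 0 (rshift 1 i)); last by rewrite row_mxEr.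
  by congr (fun_of_matrix _ _ _); apply: val_inj.
rewrite /pdot big_ord_recl /= !e0; congr (_ + _).
by apply: eq_bigr => i _; rewrite !eS.
Qed.

Lemma prependZ (R : realType) (m : nat) (c a : R) (x : 'rV[R]_m) :
  c *: prepend a x = prepend (c * a) (c *: x).
Proof.
by have := scale_row_mx c (a%:M : 'M[R]_1) x; rewrite scale_scalar_mx.
Qed.

Lemma prependD (R : realType) (m : nat) (a b : R) (x y : 'rV[R]_m) :
  prepend a x + prepend b y = prepend (a + b) (x + y).
Proof.
by have := add_row_mx (a%:M : 'M[R]_1) x b%:M y; rewrite -raddfD.
Qed.

Lemma prepend0_sum (R : realType) (m k : nat) (F : 'I_k -> 'rV[R]_m) :
  \sum_i prepend 0 (F i) = prepend 0 (\sum_i F i).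
Proof.
apply: (big_ind2 (fun x y => x = prepend 0 y)) => // [|x1 x2 y1 y2 -> ->].
  by rewrite /prepend raddf0 row_mx0.
by rewrite prependD addr0.
Qed.

Definition suspension (R : realType) (m k : nat) (a b : R)
    (P : 'I_k -> 'rV[R]_m) (i : 'I_k.+1) : 'rV[R]_m.+1 :=
  if unlift ord0 i is Some j then b *: prepend 0 (P j)
  else a *: prepend 1 0.

Lemma suspension0 (R : realType) (m k : nat) (a b : R)
    (P : 'I_k -> 'rV[R]_m) : suspension a b P ord0 = a *: prepend 1 0.
Proof. by rewrite /suspension unlift_none. Qed.

Lemma suspensionS (R : realType) (m k : nat) (a b : R)
    (P : 'I_k -> 'rV[R]_m) (i : 'I_k) :
  suspension a b P (lift ord0 i) = b *: prepend 0 (P i).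
Proof. by rewrite /suspension liftK. Qed.

(** With the apex as base point the Gram matrix is that of the points [b P_i],
    shifted by the constant [a ^+ 2]. *)
Lemma det_gram_suspension (R : realType) (p m k : nat) (a b : R)
    (P : 'I_k.+1 -> 'rV[R]_m) :
  \det (gram p.+1 (suspension a b P)) =
  (b ^+ 2) ^+ k.+1 * \det (inner_mx p P) +
  (b ^+ 2) ^+ k * a ^+ 2 * \det (gram p P).
Proof.
pose bP i := b *: P i.
have -> : gram p.+1 (suspension a b P) = inner_mx p bP + const_mx (a ^+ 2).
  apply/matrixP => i j; rewrite !mxE suspension0 !suspensionS.
  rewrite !(pdotBl, pdotBr, pdotZl, pdotZr) !pdot_prepend.
  rewrite !(pdot0l, pdot0r); ring.
rewrite det_inner_shift.
have -> : inner_mx p bP = b ^+ 2 *: inner_mx p P.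
  by apply/matrixP => i j; rewrite !mxE pdotZl pdotZr mulrA.
have -> : gram p bP = b ^+ 2 *: gram p P.
  by apply/matrixP => i j; rewrite !mxE -!scalerBr pdotZl pdotZr mulrA.
by rewrite !detZ; ring.
Qed.

Lemma factor_lift0 (k n : nat) (f : 'I_k -> 'I_n.+1) :
  injective f -> (forall i, f i != ord0) ->
  exists2 a : 'I_k -> 'I_n, injective a & forall i, f i = lift ord0 (a i).
Proof.
move=> f_inj f0.
have fS i : exists j, f i = lift ord0 j.
  by case: (unliftP ord0 (f i)) (f0 i) => [j ->|->]; [exists j | rewrite eqxx].
have [a fa] := choice fS.
by exists a => // i j aij; apply: f_inj; rewrite !fa aij.
Qed.

Lemma gram_ext (R : realType) (n p k : nat) (P Q : 'I_k.+1 -> 'rV[R]_n) :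
  P =1 Q -> gram p P = gram p Q.
Proof. by move=> PQ; apply/matrixP => i j; rewrite !mxE !PQ. Qed.

Lemma expr_inv_cancel (R : realType) (t : R) (r : nat) :
  t != 0 -> (t ^+ 2) ^+ r * (t^-1 ^+ r) ^+ 2 = 1.
Proof. by move=> t0; rewrite -!exprM mulnC -exprMn divff ?expr1n. Qed.

(** Together with the origin the points span a facet, unless the origin is
    already one of them. *)
Lemma det_inner_null (R : realType) (p r : nat) (Y : 'I_r.+3 -> 'rV[R]_r.+2)
    (a : 'I_r.+1 -> 'I_r.+3) :
  Y ord0 = 0 ->
  (forall b : 'I_r.+2 -> 'I_r.+3, injective b -> \det (gram p (Y \o b)) = 0) ->
  injective a ->
  \det (inner_mx p (Y \o a)) = 0.
Proof.
move=> Y0 Ynull a_inj; have [[i ai0]|a0] := pselect (exists i, a i = ord0).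
  rewrite (expand_det_row _ i) big1 // => j _.
  by rewrite mxE /= ai0 Y0 pdot0l mul0r.
pose b i := if unlift ord0 i is Some j then a j else ord0.
have b_inj : injective b.
  have a0' j : a j <> ord0 by move=> aj; apply: a0; exists j.
  rewrite /b => i i'.
  case: unliftP => [j ->|->]; case: unliftP => [j' ->|->] //.
  - by move/a_inj ->.
  - by move/a0'.
  - by move/esym/a0'.
rewrite -(Ynull _ b_inj); congr (\det _); apply/matrixP => i j.
by rewrite !mxE /= /b !liftK unlift_none Y0 !subr0.
Qed.

(** A face that contains the apex is reordered so as to have it as base point;
    a face without the apex is a scaled facet of [Y]. *)
Lemma det_gram_face_suspension (R : realType) (p r : nat)
    (Y : 'I_r.+3 -> 'rV[R]_r.+2) (phi : 'I_r.+2 -> 'I_r.+4) (t : R) :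
  Y ord0 = 0 ->
  (forall b : 'I_r.+2 -> 'I_r.+3, injective b -> \det (gram p (Y \o b)) = 0) ->
  t != 0 -> injective phi ->
  \det (gram p.+1 (suspension (t^-1 ^+ r) t Y \o phi)) =
  \det (gram p.+1 (suspension 1 1 Y \o phi)).
Proof.
move=> Y0 Ynull t0 phi_inj.
have [[i0 phi0]|phiN0] := pselect (exists i, phi i = ord0).
  rewrite -(det_gram_perm _ _ (tperm ord0 i0)).
  rewrite -[RHS](det_gram_perm _ _ (tperm ord0 i0)).
  pose psi i := phi (tperm ord0 i0 (lift ord0 i)).
  have psi_inj : injective psi by move=> i j /phi_inj/perm_inj/lift_inj.
  have [|a a_inj psiE] := factor_lift0 psi_inj.
    move=> i; apply/eqP; rewrite -phi0 => /phi_inj/(canRL (tpermK _ _)).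
    by rewrite tpermR => /eqP; rewrite eq_sym (negPf (neq_lift _ _)).
  have susE u v : gram p.+1 ((suspension u v Y \o phi) \o tperm ord0 i0) =
      gram p.+1 (suspension u v (Y \o a)).
    apply: gram_ext => i /=; case: (unliftP ord0 i) => [j ->|->].
      by rewrite -/(psi j) psiE !suspensionS.
    by rewrite tpermL phi0 !suspension0.
  rewrite !susE !det_gram_suspension det_inner_null // !mulr0 !add0r.
  by rewrite expr_inv_cancel // !expr1n !mul1r.
have [|a a_inj phiE] := factor_lift0 phi_inj.
  by move=> i; apply/eqP => phi0; apply: phiN0; exists i.
suff det0 u v : \det (gram p.+1 (suspension u v Y \o phi)) = 0 by rewrite !det0.
have -> : gram p.+1 (suspension u v Y \o phi) = v ^+ 2 *: gram p (Y \o a).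
  apply/matrixP => i j; rewrite !mxE /= !phiE !suspensionS -!scalerBr.
  rewrite pdotZl pdotZr !(pdotBl, pdotBr) !pdot_prepend; ring.
by rewrite detZ Ynull ?mulr0.
Qed.

Lemma continuous_suspension (R : realType) (m k r : nat) (P : 'I_k -> 'rV[R]_m)
    (i : 'I_k.+1) (t : R) : t != 0 ->
  {for t, continuous (fun u : R => suspension (u^-1 ^+ r) u P i)}.
Proof.
move=> t0; rewrite /suspension; case: unlift => [j|].
  by apply: cvgZr_tmp; apply: cvg_id.
apply: cvgZr_tmp.
apply: (@cvg_comp _ _ _ (fun u : R => u^-1) (fun u => u ^+ r)).
  exact: inv_continuous.
exact: exprn_continuous.
Qed.

(** * Congruence *)

Definition squared_distances (R : realType) (n p k : nat)
    (P : 'I_k.+1 -> 'rV[R]_n) : set R :=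
  [set q | exists x y, [/\ hull P x, hull P y & q = pdot p (x - y) (x - y)]].

Lemma congruent_squared_distances (R : realType) (n p k : nat)
    (P P' : 'I_k.+1 -> 'rV[R]_n) :
  congruent p P P' -> squared_distances p P = squared_distances p P'.
Proof.
move=> [f [_ fq] fP]; apply/seteqP; split => q [x [y [Px Py ->]]].
  exists (f x), (f y); by rewrite fq -fP.
move: Px Py; rewrite -fP => -[x' Px' <-] [y' Py' <-].
by exists x', y'; rewrite fq.
Qed.

Lemma hull_vertex (R : realType) (n k : nat) (P : 'I_k.+1 -> 'rV[R]_n) i :
  hull P (P i).
Proof.
exists (fun j => (j == i)%:R); split => [j||]; first exact: ler0n.
  by rewrite (bigD1 i) //= eqxx big1 ?addr0 // => j /negPf ->.
rewrite (bigD1 i) //= eqxx scale1r big1 ?addr0 // => j /negPf ->.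
by rewrite scale0r.
Qed.

Lemma squared_distances_lbound (R : realType) (n p k : nat)
    (P : 'I_k.+1 -> 'rV[R]_n) : has_lbound (squared_distances p P).
Proof.
pose B (i : 'I_n) := \sum_j `|P j 0 i|.
have hullB x i : hull P x -> `|x 0 i| <= B i.
  move=> [w [w0 w1 ->]]; rewrite summxE (le_trans (ler_norm_sum _ _ _)) //.
  apply: ler_sum => j _; rewrite mxE normrM ler_piMl // ger0_norm //.
  by rewrite -w1 (bigD1 j) //= lerDl sumr_ge0.
exists (\sum_(i < n) - (B i + B i) ^+ 2) => _ [x [y [Px Py ->]]].
apply: ler_sum => i _; set z := (x - y) 0 i.
have zB : z * z <= (B i + B i) ^+ 2.
  have zB : `|z| <= B i + B i.
    by rewrite /z !mxE (le_trans (ler_normB _ _)) // lerD // hullB.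
  by rewrite -expr2 -real_normK ?num_real // lerXn2r ?nnegrE // (le_trans _ zB).
have z0 : 0 <= z * z by rewrite -expr2 sqr_ge0.
by case: ifP => _; lra.
Qed.

(** The coordinate along the apex direction only increases the square, and
    without it the point [b *: u], for [u] in the hull of [P], is obtained by
    moving the weight of the apex to the vertex [P ord0 = 0]. *)
Lemma inf_squared_distances_suspension (R : realType) (m p k : nat) (a b : R)
    (P : 'I_k.+1 -> 'rV[R]_m) : P ord0 = 0 -> 0 < b ->
  inf (squared_distances p.+1 (suspension a b P)) =
  b ^+ 2 * inf (squared_distances p P).
Proof.
move=> P0 b0.
have b20 : 0 < b ^+ 2 by rewrite exprn_gt0.
have coordE (w : 'I_k.+2 -> R) : \sum_i w i *: suspension a b P i =
    prepend (w ord0 * a) (b *: \sum_i w (lift ord0 i) *: P i).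
  rewrite big_ord_recl suspension0 prependZ mulr1 prependZ !scaler0.
  under eq_bigr do rewrite suspensionS prependZ mulr0 prependZ mulr0.
  rewrite prepend0_sum prependD addr0 add0r scaler_sumr; congr (prepend _ _).
  by apply: eq_bigr => i _; rewrite !scalerA mulrC.
have ne n q l (P' : 'I_l.+1 -> 'rV[R]_n) : squared_distances q P' !=set0.
  exists (pdot q (P' ord0 - P' ord0) (P' ord0 - P' ord0)), (P' ord0), (P' ord0).
  by split=> //; apply: hull_vertex.
have lbY := squared_distances_lbound p P.
have lbQ := squared_distances_lbound p.+1 (suspension a b P).
have qE (h h' : R) x y :
    pdot p.+1 (prepend h (b *: x) - prepend h' (b *: y))
      (prepend h (b *: x) - prepend h' (b *: y)) =
    (h - h') ^+ 2 + b ^+ 2 * pdot p (x - y) (x - y).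
  rewrite !(pdotBl, pdotBr) !pdot_prepend !(pdotZl, pdotZr); ring.
have up x : hull P x -> hull (suspension a b P) (prepend 0 (b *: x)).
  move=> [w [w0 w1 ->]].
  exists (fun i => if unlift ord0 i is Some j then w j else 0); split => [i||].
  - by case: unlift.
  - rewrite big_ord_recl unlift_none add0r -w1.
    by apply: eq_bigr => i _; rewrite liftK.
  - rewrite coordE unlift_none mul0r; congr (prepend _ (_ *: _)).
    by apply: eq_bigr => i _; rewrite liftK.
apply/eqP; rewrite eq_le; apply/andP; split.
  rewrite -ler_pdivrMl //; apply: lb_le_inf; first exact: ne.
  move=> q' [x [y [Px Py ->]]]; rewrite ler_pdivrMl //; apply: ge_inf => //.
  exists (prepend 0 (b *: x)), (prepend 0 (b *: y)); split; try exact: up.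
  by rewrite qE subrr expr0n add0r.
apply: lb_le_inf; first exact: ne.
move=> _ [x [y [Qx Qy ->]]].
have down z : hull (suspension a b P) z ->
   exists2 u, hull P u & exists h, z = prepend h (b *: u).
  move=> [w [w0 w1 ->]]; rewrite coordE.
  pose w' i := w (lift ord0 i) + (if i == ord0 then w ord0 else 0).
  exists (\sum_i w (lift ord0 i) *: P i); last by exists (w ord0 * a).
  exists w'; split => [i||].
  - by rewrite /w' addr_ge0 //; case: ifP.
  - rewrite /w' big_split /= -big_mkcond big_pred1_eq.
    by rewrite -w1 [RHS]big_ord_recl addrC.
  - apply: eq_bigr => i _; rewrite /w' scalerDl.
    by case: eqP => [->|_]; rewrite ?P0 ?scaler0 ?scale0r addr0.
have [u Pu [h ->]] := down _ Qx; have [u' Pu' [h' ->]] := down _ Qy.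
rewrite qE; apply: ler_wpDl; first exact: sqr_ge0.
rewrite ler_pM2l //; apply: ge_inf => //; by exists u, u'.
Qed.

(** * The flexible family *)

(* A k-face is given by an injective labeling phi of its k+1 vertices; its
   volume does not depend on the order in which phi lists them. *)
Theorem theorem1p4 (R : realType) (n : nat)
    (hn : n = 4%N \/ ((5 <= n)%N /\ odd n)) :
  exists p : nat, (2 <= p <= n)%N /\
  exists (I : interval R) (Q : R -> 'I_n.+1 -> 'rV[R]_n),
    [/\ exists a b : R, [/\ a \in I, b \in I & a < b],
        continuous_simplex_family I Q,
        forall s t : R, s \in I -> t \in I -> s <> t ->
          ~ congruent p (Q s) (Q t),
        forall phi : 'I_(n - 2).+1 -> 'I_n.+1, injective phi ->
          forall s t : R, s \in I -> t \in I ->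
            volume p (Q s \o phi) = volume p (Q t \o phi)
      & exists s t : R, [/\ s \in I, t \in I &
          volume p (Q s) <> volume p (Q t)]].
Proof.
(* The dimension is r + 3, and Y has dimension r + 2. *)
have [r r0 ->] : exists2 r, (0 < r)%N & n = r.+3.
  case: hn => [->|[]]; first by exists 1%N.
  by case: n => [|[|[|[|r]]]] // _ _; exists r.+1.
have [Y [Y0 Yvol Ynull [i0 Yi0]]] := exists_null_facet_simplex R r0.
exists 2%N; split=> //.
pose Q t := suspension (t^-1 ^+ r) t Y.
have E : (r.+3 - 2)%N = r.+1 by rewrite subn2.
rewrite E.
have I_gt0 (t : R) : t \in `[1, 2] -> 0 < t.
  by rewrite in_itv /= => /andP[t1 _]; apply: lt_le_trans t1.
have detQ t : 0 < t -> \det (gram 2 (Q t)) = t ^+ 4 * \det (gram 1 Y).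
  move=> t0; rewrite det_gram_suspension (expand_det_row _ ord0) big1 => [|j _].
    rewrite mulr0 add0r; congr (_ * _).
    have -> : (t ^+ 2) ^+ r.+2 = (t ^+ 2) ^+ r * t ^+ 4.
      by rewrite -!exprM -exprD -[r.+2]addn2 mulnDr.
    by rewrite mulrAC expr_inv_cancel ?mul1r ?gt_eqF.
  by rewrite mxE Y0 pdot0l mul0r.
exists `[1, 2], Q; split.
- by exists 1, 2; rewrite !in_itv /= !lexx !ler1n ltr1n.
- split=> [t tI|i].
    apply: (@affinely_independent_gram _ _ 2); have t0 := I_gt0 _ tI.
    by rewrite detQ // mulf_neq0 // expf_neq0 // gt_eqF.
  apply: continuous_in_subspaceT => t; rewrite inE => tI.
  by apply: continuous_suspension; rewrite gt_eqF ?I_gt0.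
- move=> s t sI tI st /congruent_squared_distances/(congr1 inf).
  rewrite !inf_squared_distances_suspension ?I_gt0 //.
  have infY : inf (squared_distances 1 Y) < 0.
    apply: le_lt_trans Yi0; apply: ge_inf.
      exact: squared_distances_lbound.
    exists (Y i0), (Y ord0); rewrite Y0 subr0 -[in hull _ 0]Y0.
    by split => //; apply: hull_vertex.
  have infY0 : inf (squared_distances 1 Y) != 0 by rewrite lt_eqF.
  move/(mulIf infY0)/eqP; rewrite eqrXn2 ?ltW ?I_gt0 // => /eqP; exact: st.
- move=> phi phi_inj s t sI tI; rewrite /volume.
  by rewrite !(det_gram_face_suspension Y0 Ynull) ?gt_eqF ?I_gt0.
- have I1 : (1 : R) \in `[1, 2] by rewrite in_itv /= lexx ler1n.
  have I2 : (2 : R) \in `[1, 2] by rewrite in_itv /= lexx ler1n.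
  exists 1, 2; split=> //; rewrite /volume !detQ // expr1n mul1r normrM.
  rewrite sqrtrM ?normr_ge0 // -mulrA => /eqP.
  have v0 : Num.sqrt `|\det (gram 1 Y)| / (r.+3)`!%:R != 0.
    rewrite mulf_neq0 ?invr_eq0 ?pnatr_eq0 -?lt0n ?fact_gt0 //.
    by rewrite gt_eqF // sqrtr_gt0 normr_gt0.
  rewrite -[X in X == _]mul1r (inj_eq (mulIf v0)).
  move=> /eqP/(congr1 (fun x => x ^+ 2)).
  rewrite sqr_sqrtr ?normr_ge0 // ger0_norm ?exprn_ge0 // expr1n => /eqP.
  by rewrite lt_eqF // exprn_egt1 // ltr1n.
Qed.
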